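(* Let $m\ge 2$, let $D\subsetneq\mathbb{R}^m$ be a domain, and let $p\in\partial D$ be a $\mathcal{C}^{1,1}$-smooth boundary point of $D$. Then the signed distance function $d_D$ is $\mathcal{C}^{1,1}$-smooth near $p$ (i.e. in some open neighborhood of $p$). Moreover, for $x,y$ near $p$ one has $$|d_D(x)-d_D(y)-\langle\nabla d_D(x),x-y\rangle|\le\left(\frac{\chi_{D,p}}{2}+o(1)\right)\left(|x-y|^2-(d_D(x)-d_D(y))^2\right),$$ where $o(1)$ is a quantity tending to $0$ as $x,y\to p$; that is, for every $\varepsilon>0$ there is a neighborhood $V$ of $p$ such that for all $x,y\in V$ the inequality holds with $o(1)$ replaced by $\varepsilon$.
   Context: $\langle\cdot,\cdot\rangle$ and $|\cdot|$ are the Euclidean inner product and norm on $\mathbb{R}^m$. A domain is a nonempty connected open set. Set $\delta_D(x):=\min_{y\in\partial D}|x-y|$; the signed distance function $d_D:\mathbb{R}^m\to\mathbb{R}$ is defined by $d_D:=\delta_D$ on $D$ and $d_D:=-\delta_D$ on $\mathbb{R}^m\setminus D$. A function is $\mathcal{C}^{1,1}$-smooth on an open set if it is differentiable there with locally Lipschitz gradient. A point $p\in\partial D$ is a $\mathcal{C}^{1,1}$-smooth boundary point of $D$ if, in suitable Euclidean coordinates $u=(u_1,u')\in\mathbb{R}\times\mathbb{R}^{m-1}$ (obtained by a rigid motion), there is a $\mathcal{C}^{1,1}$ function $f$ of $u'$ such that, in a neighborhood of $p$, $D$ coincides with $\{u_1>f(u')\}$ (so that $\partial D$ is the graph $\{u_1=f(u')\}$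 there). For a point $q\in\partial D$ where $d_D$ is differentiable, $n_q:=\nabla d_D(q)$; at boundary points $q$ near a $\mathcal{C}^{1,1}$-smooth boundary point, $n_q$ is the inner unit normal vector to $\partial D$ at $q$. Define $$\chi_{D,p}:=\limsup_{\partial D\ni p',p''\to p}\frac{|n_{p'}-n_{p''}|}{|p'-p''|},$$ where the limsup is over pairs $p'\ne p''$ of points of $\partial D$ both tending to $p$. *)

(* Defs.v *)
(* MathComp-Analysis: R^m is 'rV[R]_m over an arbitrary R : realType. *)
From HB Require Import structures.
From mathcomp Require Import all_boot all_order all_algebra.
From mathcomp Require Import all_classical all_reals all_analysis.

Set Implicit Arguments.
Unset Strict Implicit.
Unset Printing Implicit Defensive.

Import Order.TTheory GRing.Theory Num.Theory.
Import numFieldNormedType.Exports.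

Local Open Scope classical_set_scope.
Local Open Scope ring_scope.

Section SignedDistance.
Context {R : realType}.

Definition inner {m : nat} (u v : 'rV[R]_m) : R := \sum_i u 0 i * v 0 i.

(* The library norm `|u| of a matrix is the sup norm, hence this definition.
   The two norms are equivalent, so the library notions of nbhs, open,
   closure, connected and differentiable on 'rV[R]_m are the Euclidean ones. *)
Definition enorm {m : nat} (u : 'rV[R]_m) : R := Num.sqrt (inner u u).

Definition domain {m : nat} (D : set 'rV[R]_m) : Prop :=
  [/\ D !=set0, connected D & open D].

Definition boundary {m : nat} (D : set 'rV[R]_m) : set 'rV[R]_m :=
  closure D `\` D°.

(* When boundary D is nonempty the infimum is a minimum, boundary D being
   closed; for empty boundary D the value is the irrelevant inf set0 = 0. *)
Definition bdist {m : nat} (D : set 'rV[R]_m) (x : 'rV[R]_m) : R :=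
  inf [set enorm (x - y) | y in boundary D].

Definition sdist {m : nat} (D : set 'rV[R]_m) (x : 'rV[R]_m) : R :=
  if x \in D then bdist D x else - bdist D x.

Definition grad {m : nat} (f : 'rV[R]_m -> R) (x : 'rV[R]_m) : 'rV[R]_m :=
  \row_i 'D_(delta_mx 0 i) f x.

Definition C11_on {m : nat} (U : set 'rV[R]_m) (f : 'rV[R]_m -> R) : Prop :=
  (forall x, U x -> differentiable f x) /\
  (forall x, U x -> exists (W : set 'rV[R]_m) (L : R), nbhs x W /\
     forall y z, U y -> W y -> U z -> W z ->
       enorm (grad f y - grad f z) <= L * enorm (y - z)).

(* The coordinates of x are u = (x - c) *m A = (u_1, u'), with A orthogonal.
   The number of columns of A is written 1 + m.-1 (which is m when 0 < m) so
   that lsubmx and rsubmx extract u_1 and u'.  The function f of u' is only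
   required to be C^{1,1} on some open set U of parameters. *)
Definition C11_boundary_point {m : nat} (D : set 'rV[R]_m) (p : 'rV[R]_m) :
    Prop :=
  exists (c : 'rV[R]_m) (A : 'M[R]_(m, 1 + m.-1))
         (U : set 'rV[R]_(m.-1)) (f : 'rV[R]_(m.-1) -> R)
         (W : set 'rV[R]_m),
    [/\ A *m A^T = 1%:M /\ A^T *m A = 1%:M,
        open U, C11_on U f, nbhs p W &
        forall x, W x -> let u : 'rV[R]_(1 + m.-1) := (x - c) *m A in
          U (rsubmx u) /\ (D x <-> f (rsubmx u) < lsubmx u 0 0)].

Definition normal {m : nat} (D : set 'rV[R]_m) (q : 'rV[R]_m) : 'rV[R]_m :=
  grad (sdist D) q.

(* The limit superior is extended-real valued; a priori it may be infinite. *)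
Definition chi {m : nat} (D : set 'rV[R]_m) (p : 'rV[R]_m) : \bar R :=
  limf_esup
    (fun q : 'rV[R]_m * 'rV[R]_m =>
       (enorm (normal D q.1 - normal D q.2) / enorm (q.1 - q.2))%:E)
    (within [set q | [/\ boundary D q.1, boundary D q.2 & q.1 != q.2]]
       (nbhs (p, p))).

End SignedDistance.

(* Main.v *)
Require Import Defs.
From HB Require Import structures.
From mathcomp Require Import all_boot all_order all_algebra.
From mathcomp Require Import all_classical all_reals all_analysis.
From mathcomp Require Import ring lra.
Import Order.TTheory GRing.Theory Num.Theory.
Import numFieldNormedType.Exports.
Local Open Scope classical_set_scope.
Local Open Scope ring_scope.

(** Near [p] the set [D] is [{g > 0}] with [g x = u_1 - f u'].  The vector field
[G], the gradient of [g], is Lipschitz with [|G| >= 1], so that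
[N = G / |G|] is Lipschitz and two points [q], [q'] of the boundary satisfy
[|<N q, q' - q>| <= C |q' - q|^2].

A point [x] near [p] has a nearest boundary point [q], its foot.  The open ball
about [x] through [q] does not meet the boundary, so [g] keeps its sign there,
and a ball touching the boundary at [q] from one side has its centre on the
normal line at [q]: [x = q + d(x) N q], with the right sign of [d]
(lemma [foot_point_exists]).

Let [y = q' + d(y) N q'] be a second point.  With [t = d(x)], [t' = d(y)], plain
expansion of inner products between unit vectors gives
- [d(y) - d(x) - <N q, y - x> = t' |N q - N q'|^2 / 2 - <N q, q' - q>],
- [|y - x|^2 - (t' - t)^2 = |q' - q|^2 - 2 t' <N q', q - q'> - 2 t <N q, q' - q>
  + t t' |N q - N q'|^2].
The second quantity is [(1 + o(1)) |q' - q|^2] and the first is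
[O(|q' - q|^2)].  Hence [d] is differentiable with gradient [N q] at [x]
(lemma [grad_foot]), and this gradient is Lipschitz because the foot map is
(lemma [foot_lipschitz]).

The first identity also shows that the best constant is that of the tangency
estimate for [<N q, q' - q>], since the other term has the small factor [t'].
To find it, let [|N z - N z'| <= M |z - z'|] on the boundary near [p], where
[M = chi + o(1)].  As [d] vanishes at [q] and [q'], Taylor's formula for [d]
along the chord from [q] to [q'] bounds [<N q, q' - q>] through the variation of
[grad d] on the chord, which is the variation of [N] between feet at distance
[(1 + o(1)) s |q' - q|].  The result is [(M / 2 + o(1)) |q' - q|^2]
(lemma [chord_tangent]).

Dimension at least two is what makes [p] an accumulation point of the boundary
and so [chi >= 0]; finiteness of [chi] follows from the Lipschitz bound on
[N]. *)

Set Implicit Arguments.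
Unset Strict Implicit.
Unset Printing Implicit Defensive.

(** * Euclidean norm *)

Section Euclid.
Context {R : realType} {m : nat}.
Implicit Types (u v w : 'rV[R]_m) (a : R).

Lemma innerC u v : inner u v = inner v u.
Proof. by apply: eq_bigr => i _; rewrite mulrC. Qed.

Lemma innerDl u v w : inner (u + v) w = inner u w + inner v w.
Proof. by rewrite /inner -big_split; apply: eq_bigr => i _; rewrite mxE mulrDl. Qed.

Lemma innerZl a u v : inner (a *: u) v = a * inner u v.
Proof. by rewrite /inner mulr_sumr; apply: eq_bigr => i _; rewrite mxE mulrA. Qed.

Lemma innerNl u v : inner (- u) v = - inner u v.
Proof. by rewrite -scaleN1r innerZl mulN1r. Qed.

Lemma innerDr u v w : inner u (v + w) = inner u v + inner u w.
Proof. by rewrite innerC innerDl !(innerC u). Qed.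

Lemma innerZr a u v : inner u (a *: v) = a * inner u v.
Proof. by rewrite innerC innerZl innerC. Qed.

Lemma innerNr u v : inner u (- v) = - inner u v.
Proof. by rewrite innerC innerNl innerC. Qed.

Definition innerE := (innerDl, innerDr, innerNl, innerNr, innerZl, innerZr).

Lemma inner_ge0 u : 0 <= inner u u.
Proof. by apply: sumr_ge0 => i _; rewrite -expr2 sqr_ge0. Qed.

Lemma inner_eq0 u : inner u u = 0 -> u = 0.
Proof.
move=> u0; apply/rowP => i; rewrite mxE.
have /psumr_eq0P/(_ i isT)/eqP := u0.
by rewrite mulf_eq0 orbb => H; apply/eqP/H => j _; rewrite -expr2 sqr_ge0.
Qed.

Lemma enorm_ge0 u : 0 <= enorm u.
Proof. exact: sqrtr_ge0. Qed.

Lemma sqr_enorm u : enorm u ^+ 2 = inner u u.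
Proof. by rewrite sqr_sqrtr // inner_ge0. Qed.

Lemma enorm_eq0 u : enorm u = 0 -> u = 0.
Proof. by move=> u0; apply: inner_eq0; rewrite -sqr_enorm u0 expr0n. Qed.

Lemma enorm0 : enorm (0 : 'rV[R]_m) = 0.
Proof. by rewrite /enorm -(scale0r 0) innerZl mul0r sqrtr0. Qed.

Lemma enorm_gt0 u : u != 0 -> 0 < enorm u.
Proof.
move=> u0; rewrite lt_neqAle enorm_ge0 andbT eq_sym.
by apply: contraNneq u0 => /enorm_eq0 ->.
Qed.

Lemma enormZ a u : enorm (a *: u) = `|a| * enorm u.
Proof.
by rewrite /enorm innerZl innerZr mulrA -expr2 sqrtrM ?sqr_ge0 // sqrtr_sqr.
Qed.

Lemma enormN u : enorm (- u) = enorm u.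
Proof. by rewrite -scaleN1r enormZ normrN1 mul1r. Qed.

Lemma enormB u v : enorm (u - v) = enorm (v - u).
Proof. by rewrite -enormN opprB. Qed.

(** The square of [|u|^2 v - <u, v> u] is [|u|^2] times the difference of the
two squared sides. *)
Lemma cauchy_schwarz u v : `|inner u v| <= enorm u * enorm v.
Proof.
have [->|u0] := eqVneq u 0.
  by rewrite -(scale0r (0 : 'rV_m)) innerZl enormZ mul0r normr0 !mul0r.
rewrite -[leRHS]ger0_norm ?mulr_ge0 ?enorm_ge0 // -ler_sqr ?nnegrE //.
rewrite !real_normK ?num_real // exprMn !sqr_enorm.
have := inner_ge0 (inner u u *: v - inner u v *: u).
rewrite !innerE (innerC v u).
have : 0 < inner u u by rewrite -sqr_enorm exprn_gt0 // enorm_gt0.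
set a := inner u u; set b := inner u v; set c := inner v v => a0.
rewrite [X in 0 <= X](_ : _ = a * (a * c - b ^+ 2)); last by ring.
by rewrite pmulr_rge0 // subr_ge0.
Qed.

Lemma inner_le u v : inner u v <= enorm u * enorm v.
Proof. exact: le_trans (ler_norm _) (cauchy_schwarz u v). Qed.

Lemma ler_enormD u v : enorm (u + v) <= enorm u + enorm v.
Proof.
rewrite -ler_sqr ?nnegrE ?addr_ge0 ?enorm_ge0 // sqr_enorm !innerE (innerC v u).
rewrite sqrrD !sqr_enorm; have := inner_le u v; lra.
Qed.

Lemma ler_enorm_distD w u v : enorm (u - v) <= enorm (u - w) + enorm (w - v).
Proof. by apply: le_trans (ler_enormD _ _); rewrite addrA subrK. Qed.

Lemma ball_segment (p x y : 'rV[R]_m) (r s : R) : 0 <= s <= 1 ->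
  enorm (x - p) < r -> enorm (y - p) < r -> enorm (x + s *: (y - x) - p) < r.
Proof.
move=> /andP[s0 s1] xr yr.
have -> : x + s *: (y - x) - p = (1 - s) *: (x - p) + s *: (y - p).
  by apply/rowP => i; rewrite !mxE; ring.
apply: le_lt_trans (ler_enormD _ _) _.
rewrite !enormZ (ger0_norm s0) ger0_norm ?subr_ge0 //.
have [->|] := eqVneq s 0; first by rewrite subr0; lra.
move=> sn0; have : 0 < s by rewrite lt_neqAle eq_sym sn0.
nra.
Qed.

Lemma coord_le_enorm u i : `|u 0 i| <= enorm u.
Proof.
rewrite -ler_sqr ?nnegrE ?enorm_ge0 // real_normK ?num_real // sqr_enorm.
rewrite /inner (bigD1 i) //= -expr2 lerDl sumr_ge0 // => j _.
by rewrite -expr2 sqr_ge0.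
Qed.

Lemma normr_le_enorm u : `|u| <= enorm u.
Proof.
rewrite -[leLHS]/(mx_norm u) mx_normrE; apply: bigmax_le => [|[i j] _ /=]; first exact: enorm_ge0.
by rewrite (ord1 i) coord_le_enorm.
Qed.

Lemma enorm_le_normr u : enorm u <= (m%:R + 1) * `|u|.
Proof.
rewrite -ler_sqr ?nnegrE ?enorm_ge0 ?mulr_ge0 ?addr_ge0 //.
rewrite sqr_enorm /inner exprMn.
have : \sum_(i < m) u 0 i * u 0 i <= \sum_(i < m) `|u| ^+ 2.
  apply: ler_sum => i _; rewrite -expr2 -real_normK ?num_real //.
  rewrite lerXn2r ?nnegrE // -[leRHS]/(mx_norm u) mx_normrE.
  exact: (le_bigmax _ (fun ij => `|u ij.1 ij.2|) (0, i)).
move/le_trans; apply; rewrite sumr_const card_ord -mulr_natl.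
have := sqr_ge0 `|u|; have := ler0n R m; set t := `|u| ^+ 2; nra.
Qed.

(** The ambient topology comes from the sup norm; through this equivalence
everything below is phrased with Euclidean balls. *)
Lemma nbhs_enormP (p : 'rV[R]_m) (A : set 'rV[R]_m) :
  nbhs p A <-> exists2 r : R, 0 < r & forall x, enorm (x - p) < r -> A x.
Proof.
split.
  move/(@nbhs_normP R 'rV[R]_m p A) => [r /= r0 rA]; exists r => // x xr; apply: rA => /=.
  by rewrite distrC; apply: le_lt_trans (normr_le_enorm _) xr.
move=> [r r0 rA]; apply/(@nbhs_normP R 'rV[R]_m p A).
have c0 : 0 < m%:R + 1 :> R by rewrite ltr_wpDl.
exists (r / (m%:R + 1)) => /=; first by rewrite divr_gt0.
move=> x /=; rewrite distrC ltr_pdivlMr // mulrC => xr; apply: rA.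
exact: le_lt_trans (enorm_le_normr _) xr.
Qed.

Lemma open_eball (p : 'rV[R]_m) (r : R) : open [set x | enorm (x - p) < r].
Proof.
rewrite openE => x /= xr; rewrite /interior; apply/nbhs_enormP.
exists (r - enorm (x - p)); first by rewrite subr_gt0.
move=> y /= yx; have := ler_enorm_distD x y p; lra.
Qed.

Lemma enorm_continuous (p : 'rV[R]_m) : continuous (fun x : 'rV[R]_m => enorm (p - x)).
Proof.
move=> x; apply/(@cvgrPdist_lt _ _ _ _ (nbhs_filter x)) => e e0 /=; apply/nbhs_enormP; exists e => // y yx.
have := ler_enorm_distD x p y; have := ler_enorm_distD y p x.
by rewrite (enormB x y) ltr_norml; lra.
Qed.

(** For the unit vectors along [u] and [v], [|u| |v|] times their squared
distance equals [2 (|u| |v| - <u, v>)], which is at most [|u - v|^2]. *)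
Lemma enorm_normalizeB u v : 1 <= enorm u -> 1 <= enorm v ->
  enorm ((enorm u)^-1 *: u - (enorm v)^-1 *: v) <= enorm (u - v).
Proof.
move=> u1 v1; rewrite -ler_sqr ?nnegrE ?enorm_ge0 // !sqr_enorm !innerE.
rewrite (innerC v u) -!sqr_enorm; have := inner_le u v.
set a := enorm u in u1 *; set b := enorm v in v1 *; set c := inner u v => cab.
have a0 : a != 0 by rewrite gt_eqF; lra.
have b0 : b != 0 by rewrite gt_eqF; lra.
rewrite [leLHS](_ : _ = 2 * (a * b - c) / (a * b)); last by field; rewrite a0 b0.
have ab1 : 1 <= a * b by nra.
rewrite ler_pdivrMr; last by lra.
rewrite [X in _ <= X * _](_ : _ = (a - b) ^+ 2 + 2 * (a * b - c)); last by ring.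
have := sqr_ge0 (a - b); set t := (a - b) ^+ 2; set s := a * b - c => t0.
have : 0 <= s by rewrite subr_ge0.
nra.
Qed.

Lemma inner_delta u i : inner u (delta_mx 0 i) = u 0 i.
Proof.
rewrite /inner (bigD1 i) //= mxE !eqxx mulr1 big1 ?addr0 // => j ji.
by rewrite mxE (negPf ji) andbF mulr0.
Qed.

End Euclid.

(** * Gradients and Taylor's formula *)

(** The mean value theorem applied to [f s - c s - e M s^2 / 2], whose derivative
has a constant sign for [e = 1] and for [e = -1]. *)
Lemma taylor_interval {R : realType} (f df : R -> R) (c M : R) :
  (forall s : R, 0 <= s <= 1 -> is_derive s 1 f (df s)) ->
  (forall s : R, 0 <= s <= 1 -> `|df s - c| <= M * s) ->
  `|f 1 - f 0 - c| <= M / 2.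
Proof.
move=> dfP bnd.
have key (e : R) : exists2 s, 0 <= s <= 1 &
    f 1 - f 0 - c - e * (M / 2) = df s - c - e * (M * s).
  pose g : R -> R := f + (fun s => - c * s + - (e * M / 2) * s ^+ 2).
  have dg (s : R) : 0 <= s <= 1 -> is_derive (s : R) (1 : R) g (df s - c - e * (M * s)).
    move=> s01; have := dfP s s01 => dfs; apply: is_derive_eq.
    by rewrite /GRing.scale /=; field.
  have [||s s01 gs] := @MVT R g (fun s => df s - c - e * (M * s)) 0 1 ltr01.
    by move=> s /[!in_itv]/= /andP[s0 s1]; apply: dg; rewrite !ltW.
    apply: derivable_within_continuous => s /[!in_itv]/= s01.
    by have [] := dg s s01.
  exists s; first by move: s01; rewrite in_itv /= => /andP[s0 s1]; rewrite !ltW.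
  move: gs; rewrite /g /= !fctE; lra.
rewrite ler_norml; apply/andP; split.
- have [s /[dup] s01 /bnd] := key (-1); rewrite ler_norml => /andP[]; lra.
- have [s /[dup] s01 /bnd] := key 1; rewrite ler_norml => /andP[]; lra.
Qed.

Section Gradient.
Context {R : realType} {m : nat}.
Implicit Types (F : 'rV[R]_m -> R) (x v a : 'rV[R]_m).

Lemma diff_grad F x v : differentiable F x -> 'd F x v = inner (grad F x) v.
Proof.
move=> dF; rewrite {1}(row_sum_delta v) linear_sum; apply: eq_bigr => i _.
by rewrite linearZ /= mxE deriveE // mulrC.
Qed.

(** The only way in which differentiability is established below: both the
defining function and the signed distance come with a quadratic expansion. *)
Lemma differentiable_quadratic F x a (K r : R) : 0 < r ->
  (forall y, enorm (y - x) < r ->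
     `|F y - F x - inner a (y - x)| <= K * enorm (y - x) ^+ 2) ->
  differentiable F x /\ grad F x = a.
Proof.
move=> r0 quad.
have la : linear (inner a : 'rV[R]_m -> R^o).
  by move=> k u v; rewrite innerDr innerZr.
pose L : {linear 'rV[R]_m -> R^o} :=
  HB.pack (inner a : 'rV[R]_m -> R^o) (GRing.isLinear.Build _ _ _ _ _ la).
have cL : continuous (L : 'rV[R]_m -> R).
  move=> y; apply/(@cvgrPdist_lt _ _ _ _ (nbhs_filter y)) => e e0 /=.
  have c0 : 0 < enorm a + 1 by rewrite ltr_wpDl ?enorm_ge0.
  apply/nbhs_enormP; exists (e / (enorm a + 1)); first by rewrite divr_gt0.
  move=> z; rewrite ltr_pdivlMr // => zy.
  rewrite -innerNr -innerDr; apply: le_lt_trans (cauchy_schwarz _ _) _.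
  rewrite enormB; apply: le_lt_trans zy; rewrite mulrC ler_wpM2l ?enorm_ge0 //.
  by rewrite lerDl.
have exp : F \o shift x = cst (F x) + (L : 'rV[R]_m -> R) +o_ (0 : 'rV[R]_m) id.
  apply/(@eqaddoP R 'rV[R]_m R^o 'rV[R]_m) => e e0; apply/nbhs_enormP.
  have c0 : 0 < (`|K| + 1) * (m%:R + 1) by rewrite mulr_gt0 // ltr_wpDl.
  exists (Num.min r (e / ((`|K| + 1) * (m%:R + 1)))).
    by rewrite lt_min r0 divr_gt0.
  move=> h; rewrite subr0 lt_min => /andP[hr he] /=.
  rewrite !fctE /=.
  have := quad (h + x); rewrite addrK => /(_ hr).
  rewrite opprD addrA => /le_trans; apply.
  move: he; rewrite ltr_pdivlMr // => /ltW he.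
  apply: le_trans (ler_wpM2r (normr_ge0 h) he).
  have hn := enorm_le_normr h; have h0 := enorm_ge0 h; have K1 := ler_norm K.
  have -> : enorm h * ((`|K| + 1) * (m%:R + 1)) * `|h| =
            (`|K| + 1) * (enorm h * ((m%:R + 1) * `|h|)) by ring.
  apply: (@le_trans _ _ ((`|K| + 1) * enorm h ^+ 2)).
    by rewrite ler_wpM2r ?sqr_ge0 //; lra.
  by rewrite ler_wpM2l ?addr_ge0 // expr2 ler_wpM2l.
have dE : 'd F x = L :> (_ -> _) by exact: diff_unique.
have dF : differentiable F x by apply/diff_locallyP; rewrite dE.
split=> //; apply/rowP => i.
by rewrite mxE deriveE // dE /= inner_delta.
Qed.

Lemma derive_line F x v (s : R) : differentiable F (x + s *: v) ->
  is_derive s 1 (fun t => F (x + t *: v)) (inner (grad F (x + s *: v)) v).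
Proof.
move=> dF.
have dl : is_diff s (fun t : R => x + t *: v) (fun t => t *: v).
  have -> : (fun t : R => x + t *: v) = cst x + *:%R ^~ v by [].
  have H := is_diffD (is_diff_cst x s) (is_diff_scalel s v).
  by apply: (is_diff_eq H); apply/funext => t; rewrite !fctE add0r.
have dl1 := @ex_diff _ _ _ _ _ _ _ dl.
have dc : differentiable (F \o (fun t : R => x + t *: v)) s.
  exact: differentiable_comp.
apply: DeriveDef; first exact/derivable1_diffP.
rewrite deriveE // diff_comp // /= diff_val scale1r diff_grad //.
Qed.

(** Lipschitz control is required only in comparison with the initial point [x],
and only for the component along [v]; the chords of the boundary used later
give no more than this. *)
Lemma taylor_segment F x v (M : R) :
  (forall s : R, 0 <= s <= 1 -> differentiable F (x + s *: v)) ->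
  (forall s : R, 0 <= s <= 1 ->
     `|inner (grad F (x + s *: v) - grad F x) v| <= M * s) ->
  `|F (x + v) - F x - inner (grad F x) v| <= M / 2.
Proof.
move=> dF gF.
have := @taylor_interval R (fun s => F (x + s *: v))
  (fun s => inner (grad F (x + s *: v)) v) (inner (grad F x) v) M.
rewrite scale1r scale0r addr0; apply=> s s01; first exact/derive_line/dF.
by rewrite -innerNl -innerDl gF.
Qed.

End Gradient.

(** * A defining function with Lipschitz gradient *)

Section IsometryInner.
Context {R : realType}.

Lemma inner_mulmx m n (A : 'M[R]_(m, n)) (u : 'rV[R]_m) (v : 'rV[R]_n) :
  inner (u *m A) v = inner u (v *m A^T).
Proof.
have innerM k (a b : 'rV[R]_k) : inner a b = (a *m b^T) 0 0.
  by rewrite mxE; apply: eq_bigr => i _; rewrite [b^T _ _]mxE.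
by rewrite !innerM trmx_mul trmxK mulmxA.
Qed.

Lemma enorm_mulmx m n (A : 'M[R]_(m, n)) (u : 'rV[R]_m) :
  A *m A^T = 1%:M -> enorm (u *m A) = enorm u.
Proof. by move=> AA; rewrite /enorm inner_mulmx -mulmxA AA mulmx1. Qed.

Lemma inner_row_mx m n (a c : 'rV[R]_m) (b d : 'rV[R]_n) :
  inner (row_mx a b) (row_mx c d) = inner a c + inner b d.
Proof.
rewrite /inner big_split_ord /=; congr (_ + _); apply: eq_bigr => i _.
  by rewrite !row_mxEl.
by rewrite !row_mxEr.
Qed.

Lemma enorm_rsubmx m n (u : 'rV[R]_(m + n)) : enorm (rsubmx u) <= enorm u.
Proof.
rewrite -ler_sqr ?nnegrE ?enorm_ge0 // !sqr_enorm -[in leRHS](hsubmxK u).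
by rewrite inner_row_mx lerDr inner_ge0.
Qed.

End IsometryInner.

Section DefiningFunction.
Context {R : realType} {m : nat}.
Implicit Types (D : set 'rV[R]_m) (p x y : 'rV[R]_m).

(** The vector field [G] plays the part of the gradient of [g]; the expansion
of the first clause is all that is ever needed of this relation. *)
Definition defining_function D p (g : 'rV[R]_m -> R) (G : 'rV[R]_m -> 'rV[R]_m)
    (C rho : R) : Prop :=
  [/\ forall x y, enorm (x - p) < rho -> enorm (y - p) < rho ->
        `|g y - g x - inner (G x) (y - x)| <= C * enorm (y - x) ^+ 2,
      forall x y, enorm (x - p) < rho -> enorm (y - p) < rho ->
        enorm (G x - G y) <= C * enorm (x - y),
      forall x, enorm (x - p) < rho -> 1 <= enorm (G x) &
      forall x, enorm (x - p) < rho -> (D x <-> 0 < g x)].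

(** In the rotated coordinates, [g = u_1 - f u'] and [G] is the row [(1, - grad f)]
rotated back. *)
Lemma C11_boundary_point_defining_function D p : C11_boundary_point D p ->
  exists g G C rho, [/\ 0 <= C, 0 < rho & defining_function D p g G C rho].
Proof.
move=> [c [A [U [f [W [[AAT ATA] oU [df Lf] nW WD]]]]]].
pose h x : 'rV[R]_(1 + m.-1) := (x - c) *m A.
pose pr x := rsubmx (h x).
have hB x y : h x - h y = (x - y) *m A.
  by rewrite /h -mulmxBl; congr (_ *m _); rewrite opprB addrA subrK.
have prB x y : pr x - pr y = rsubmx ((x - y) *m A) by rewrite /pr -hB linearB.
have prL x y : enorm (pr x - pr y) <= enorm (x - y).
  by rewrite prB (le_trans (enorm_rsubmx _)) // enorm_mulmx.
have Up : U (pr p) by have [] := WD p (@nbhs_singleton _ _ _ nW).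
have [W' [L [nW' LP]]] := Lf _ Up.
have /nbhs_enormP[r1 r10 r1W] := nW.
have /nbhs_enormP[r2 r20 r2W'] : nbhs (pr p) (W' `&` U).
  by apply: filterI => //; exact: open_nbhs_nbhs.
exists (fun x => lsubmx (h x) 0 0 - f (pr x)).
pose G x := row_mx (const_mx 1 : 'rV_1) (- grad f (pr x)) *m A^T.
exists G, `|L|, (Num.min r1 r2); split=> //; first by rewrite lt_min r10.
have in2 x : enorm (x - p) < Num.min r1 r2 -> enorm (pr x - pr p) < r2.
  rewrite lt_min => /andP[_]; exact: le_lt_trans.
have gradL v w : enorm (v - pr p) < r2 -> enorm (w - pr p) < r2 ->
    enorm (grad f v - grad f w) <= `|L| * enorm (v - w).
  move=> /r2W'[Wv Uv] /r2W'[Ww Uw]; apply: le_trans (LP _ _ Uv Wv Uw Ww) _.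
  by rewrite ler_wpM2r ?enorm_ge0 // ler_norm.
split.
- move=> x y /in2 xr /in2 yr.
  rewrite inner_mulmx trmxK -hB -[h y - h x]hsubmxK inner_row_mx innerNl.
  have -> : rsubmx (h y - h x) = pr y - pr x by rewrite linearB.
  have -> : inner (const_mx 1 : 'rV[R]_1) (lsubmx (h y - h x)) =
            lsubmx (h y) 0 0 - lsubmx (h x) 0 0.
    by rewrite /inner big_ord1 mxE mul1r linearB /= !mxE.
  rewrite [X in `|X|](_ : _ =
    - (f (pr y) - f (pr x) - inner (grad f (pr x)) (pr y - pr x))); last by ring.
  have yE : pr y = pr x + (pr y - pr x) by rewrite addrC subrK.
  rewrite normrN {1}yE.
  apply: (@le_trans _ _ (`|L| * enorm (pr y - pr x) ^+ 2 / 2)).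
    apply: taylor_segment => s s01.
      by apply: df; have [] := r2W' _ (ball_segment s01 xr yr).
    apply: le_trans (cauchy_schwarz _ _) _.
    have := gradL _ _ (ball_segment s01 xr yr) xr.
    rewrite (addrC (pr x)) addrK enormZ (ger0_norm (proj1 (andP s01))).
    move=> gs; apply: le_trans (ler_wpM2r (enorm_ge0 _) gs) _.
    by rewrite le_eqVlt; apply/orP; left; apply/eqP; ring.
  have := prL y x; have := enorm_ge0 (pr y - pr x).
  set a := enorm _; set b := enorm _ => a0 ab.
  have : a ^+ 2 <= b ^+ 2 by rewrite lerXn2r ?nnegrE ?(le_trans a0 ab).
  have := normr_ge0 L; have := sqr_ge0 b; set b2 := b ^+ 2; set a2 := a ^+ 2; nra.
- move=> x y /in2 xr /in2 yr.
  rewrite -mulmxBl enorm_mulmx ?trmxK // opp_row_mx add_row_mx subrr.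
  have -> : enorm (row_mx (0 : 'rV[R]_1) (- grad f (pr x) - - grad f (pr y))) =
            enorm (grad f (pr x) - grad f (pr y)).
    rewrite /enorm inner_row_mx -[inner 0 0]sqr_enorm enorm0 expr0n add0r.
    by rewrite -opprD innerNl innerNr opprK.
  by apply: le_trans (gradL _ _ xr yr) _; rewrite ler_wpM2l.
- move=> x _; rewrite enorm_mulmx ?trmxK //.
  apply: le_trans (coord_le_enorm _ (lshift _ 0)).
  by rewrite row_mxEl mxE normr1.
- move=> x; rewrite lt_min => /andP[/r1W /WD[_ ->] _].
  by rewrite subr_gt0.
Qed.

End DefiningFunction.

(** * Nearest points and touching balls *)

Section FootPoint.
Context {R : realType} {m : nat}.
Implicit Types (D S : set 'rV[R]_m) (p q x y a : 'rV[R]_m).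

Lemma nearest_point S p x : closed S -> S p ->
  exists2 q, S q & forall z, S z -> enorm (x - q) <= enorm (x - z).
Proof.
move=> cS Sp; pose K := S `&` [set y | enorm (x - y) <= enorm (x - p)].
have cK : compact K.
  apply: bounded_closed_compact.
    exists (enorm x + enorm (x - p)); split; first exact: num_real.
    move=> M MM y [_ /= yx]; apply: le_trans (normr_le_enorm _) _.
    have := ler_enormD x (y - x); rewrite addrC subrK enormB; lra.
  apply: closedI => //; rewrite (_ : [set _ | _] =
    (fun y => enorm (x - y)) @^-1` [set t | t <= enorm (x - p)]) //.
  by apply: closed_comp; [move=> y _; exact: enorm_continuous|exact: closed_le].
have [||q /set_mem[Sq qp] qmin] :=
  @EVT_min_rV R m (fun y => enorm (x - y)) K _ cK.
- by exists p; split => /=.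
- exact/continuous_subspaceT/enorm_continuous.
exists q => // z Sz; have [zp|/ltW pz] := leP (enorm (x - z)) (enorm (x - p)).
  by apply: qmin; apply/mem_set.
exact: le_trans qp pz.
Qed.

(** If [x - q] were not a positive multiple of [a], moving from [q] in the
direction [x - q - |x - q| a] would enter the ball while decreasing the inner
product with [a] at a linear rate, which the quadratic term cannot offset. *)
Lemma touching_ball x q a (C : R) : 0 <= C -> enorm a = 1 ->
  (forall y, enorm (y - x) < enorm (x - q) ->
     0 <= inner a (y - q) + C * enorm (y - q) ^+ 2) ->
  x - q = enorm (x - q) *: a.
Proof.
move=> C0 a1 H; apply: contrapT => neq.
set d := enorm (x - q) in H neq *; pose e := x - q - d *: a.
have d0 : 0 <= d by exact: enorm_ge0.
have dd : inner (x - q) (x - q) = d ^+ 2 by rewrite -sqr_enorm.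
have aa : inner a a = 1 by rewrite -sqr_enorm a1 expr1n.
pose E := inner e e.
have E0 : 0 < E.
  rewrite /E -sqr_enorm exprn_gt0 // enorm_gt0 //.
  by apply/eqP => /eqP; rewrite subr_eq0 => /eqP.
have E1 : E = 2 * (d ^+ 2 - d * inner a (x - q)).
  rewrite /E /e innerDl innerDr [inner (- _) _]innerDr !(innerNl, innerNr).
  by rewrite !(innerZl, innerZr) dd aa (innerC _ a); ring.
have ex : inner e (x - q) = E / 2.
  by rewrite E1 /e innerDl innerNl innerZl dd; field.
have ea : d * inner a e = - (E / 2).
  by rewrite E1 /e innerDr innerNr innerZr aa; field.
have dC : 0 <= d * C by exact: mulr_ge0.
pose s := (2 + 2 * (d * C))^-1.
have s0 : 0 < s by rewrite invr_gt0; lra.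
have sE : s * (2 + 2 * (d * C)) = 1 by rewrite mulVf // gt_eqF //; lra.
have s1 : s < 1 by nra.
have qe : q + s *: e - q = s *: e by rewrite addrAC subrr add0r.
have := H (q + s *: e); rewrite qe.
have -> : enorm (s *: e) ^+ 2 = s ^+ 2 * E.
  by rewrite sqr_enorm innerZl innerZr /E; ring.
have -> : (enorm (q + s *: e - x) < d).
  rewrite -ltr_sqr ?nnegrE ?enorm_ge0 // sqr_enorm.
  have -> : q + s *: e - x = s *: e - (x - q).
    by rewrite opprB addrCA addrA.
  rewrite innerDl innerDr [inner (- _) _]innerDr !(innerNl, innerNr).
  rewrite !(innerZl, innerZr) dd (innerC (x - q)) ex -/E.
  have : 0 < s * E * (1 - s) by rewrite !mulr_gt0 // subr_gt0.
  lra.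
rewrite innerZr => /(_ isT) /(ler_wpM2l d0); rewrite mulr0.
have -> : d * (s * inner a e + C * (s ^+ 2 * E)) =
  s * (d * inner a e) + s * s * (d * C) * E by ring.
rewrite ea; suff : s * s * (d * C) * E < s * E / 2 by lra.
have : 0 < s * E by exact: mulr_gt0.
have -> : s * s * (d * C) * E = (s * E) * (s * (d * C)) by ring.
nra.
Qed.

End FootPoint.

(** * Normal lines to the boundary *)

Section Tube.
Context {R : realType} {m : nat}.
Context (D : set 'rV[R]_m) (p : 'rV[R]_m) (g : 'rV[R]_m -> R).
Context (G : 'rV[R]_m -> 'rV[R]_m) (C rho : R).
Context (oD : open D) (C0 : 0 <= C) (dfg : defining_function D p g G C rho).
Implicit Types q x y : 'rV[R]_m.

Definition unit_normal x := (enorm (G x))^-1 *: G x.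

Lemma enorm_unit_normal x : enorm (x - p) < rho -> enorm (unit_normal x) = 1.
Proof.
have [_ _ G1 _] := dfg => /G1 Gx.
by rewrite enormZ ger0_norm ?invr_ge0 ?enorm_ge0 // mulVf // gt_eqF //; lra.
Qed.

Lemma unit_normal_lipschitz x y :
  enorm (x - p) < rho -> enorm (y - p) < rho ->
  enorm (unit_normal x - unit_normal y) <= C * enorm (x - y).
Proof.
have [_ GL G1 _] := dfg => xr yr.
apply: le_trans (GL _ _ xr yr).
by apply: enorm_normalizeB; exact: G1.
Qed.

Lemma differentiable_defining x : enorm (x - p) < rho -> differentiable g x.
Proof.
have [gq _ _ _] := dfg => xr.
have r0 : 0 < rho - enorm (x - p) by rewrite subr_gt0.
have [|//] := @differentiable_quadratic R m g x (G x) C _ r0.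
by move=> y yx; apply: gq => //; have := ler_enorm_distD x y p; lra.
Qed.

Lemma boundary_defining q :
  enorm (q - p) < rho -> boundary D q <-> g q = 0.
Proof.
have [gq _ G1 gD] := dfg => qr.
have DD : D° = D by exact/interior_id.
rewrite /boundary DD; split.
  case=> clq nDq; apply/eqP; rewrite eq_le.
  have /= -> : g q <= 0 by rewrite leNgt; apply/negP => /(gD _ qr).
  rewrite leNgt; apply/negP => gq0.
  have cg : {for q, continuous g}.
    exact/differentiable_continuous/differentiable_defining.
  have nU : nbhs q [set y | enorm (y - p) < rho /\ g y < 0].
    apply: filterI; first by apply: open_nbhs_nbhs; split=> //; exact: open_eball.
    exact: (cvgr_lt _ cg).
  have [y [Dy [yr]]] := clq _ nU.
  by have := (gD _ yr).1 Dy; lra.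
move=> g0; split; last by move/(gD _ qr); rewrite g0 ltxx.
move=> V /nbhs_enormP[e e0 eV].
have Gq := G1 _ qr; have Gq0 : 0 < enorm (G q) by lra.
pose e' := Num.min e (rho - enorm (q - p)).
have e'0 : 0 < e' by rewrite lt_min e0 subr_gt0.
have [e'e e'r] : e' <= e /\ e' <= rho - enorm (q - p).
  by rewrite !ge_min !lexx orbT.
(* Moving from [q] along [G q] increases [g] at least linearly. *)
pose s := Num.min (e' / (2 * enorm (G q))) (2 * (C + 1))^-1.
have n0 : 0 < 2 * enorm (G q) by lra.
have k0 : 0 < 2 * (C + 1) by have := C0; lra.
have s0 : 0 < s by rewrite lt_min divr_gt0 //= invr_gt0.
have s1 : s * enorm (G q) < e'.
  have : s <= e' / (2 * enorm (G q)) by rewrite ge_min lexx.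
  by rewrite ler_pdivlMr //; lra.
have s2 : s * C < 1.
  have : s <= (2 * (C + 1))^-1 by rewrite ge_min lexx orbT.
  by rewrite -[_^-1]mul1r ler_pdivlMr //; have := C0; lra.
pose y := q + s *: G q.
have yq : y - q = s *: G q by rewrite /y addrAC subrr add0r.
have yqn : enorm (y - q) = s * enorm (G q) by rewrite yq enormZ gtr0_norm.
exists y; split; last by apply: eV; rewrite yqn; lra.
have yr : enorm (y - p) < rho by have := ler_enorm_distD q y p; lra.
apply/(gD _ yr); have := gq _ _ qr yr.
rewrite g0 subr0 ler_norml yqn yq innerZr -sqr_enorm => /andP[+ _].
set n := enorm (G q) in Gq Gq0 *.
have : 0 < s * n ^+ 2 * (1 - s * C) by rewrite !mulr_gt0 // ?exprn_gt0 // subr_gt0.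
lra.
Qed.

(** The intermediate value theorem: [g] vanishes somewhere on the segment. *)
Lemma boundary_on_segment x y :
  enorm (x - p) < rho -> enorm (y - p) < rho ->
  Num.min (g x) (g y) <= 0 <= Num.max (g x) (g y) ->
  exists2 s : R, 0 <= s <= 1 & boundary D (x + s *: (y - x)).
Proof.
move=> xr yr xy0.
have seg (s : R) : 0 <= s <= 1 -> enorm (x + s *: (y - x) - p) < rho.
  by move=> s01; exact: ball_segment.
have [||s s01 gs] := @IVT R (fun s => g (x + s *: (y - x))) 0 1 0 ler01.
- apply: derivable_within_continuous => s /[!in_itv]/= s01.
  by have [] := derive_line (differentiable_defining (seg _ s01)).
- by rewrite scale0r scale1r addr0 addrC subrK.
rewrite in_itv /= in s01; exists s => //.
by apply/boundary_defining => //; exact: seg.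
Qed.

(** Since [g] vanishes at both points, its expansion reduces to the linear
term. *)
Lemma unit_normal_tangent q q' :
  boundary D q -> boundary D q' -> enorm (q - p) < rho -> enorm (q' - p) < rho ->
  `|inner (unit_normal q) (q' - q)| <= C * enorm (q' - q) ^+ 2.
Proof.
have [gq _ G1 _] := dfg.
move=> bq bq' qr q'r; have := gq _ _ qr q'r.
rewrite ((boundary_defining qr).1 bq) ((boundary_defining q'r).1 bq').
rewrite subrr sub0r normrN innerZl normrM => gqq; have Gq := G1 _ qr.
apply: le_trans gqq; rewrite ler_piMl // ger0_norm ?invr_ge0 ?enorm_ge0 //.
by rewrite invf_le1 //; lra.
Qed.

Hypothesis bp : boundary D p.

(** The ball about [x] through its nearest boundary point [q] contains no zero of
[g].  Hence [g] has there the sign it has at [x], which makes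
[touching_ball] applicable with [a = unit_normal q] for [x] in [D] and
[a = - unit_normal q] otherwise. *)
Lemma foot_point_exists x : 2 * enorm (x - p) < rho ->
  exists q, [/\ boundary D q, enorm (q - p) <= 2 * enorm (x - p),
    x = q + sdist D x *: unit_normal q & `|sdist D x| <= enorm (x - p)].
Proof.
have [gq _ G1 gD] := dfg => xr.
have cB : closed (boundary D).
  apply: closedI; first exact: closed_closure.
  exact/open_closedC/open_interior.
have [q bq qmin] := nearest_point x cB bp.
have bd : bdist D x = enorm (x - q).
  apply/eqP; rewrite eq_le; apply/andP; split.
    apply: ge_inf; last by exists q.
    by exists 0 => _ [z _ <-]; exact: enorm_ge0.
  apply: lb_le_inf; first by exists (enorm (x - q)), q.
  by move=> _ [z bz <-]; exact: qmin.
have qx := qmin _ bp.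
have x0 := enorm_ge0 (x - p).
have qp : enorm (q - p) <= 2 * enorm (x - p).
  by have := ler_enorm_distD x q p; rewrite (enormB q x); lra.
have xr1 : enorm (x - p) < rho by lra.
have qr : enorm (q - p) < rho by lra.
exists q; split=> //; last first.
  by rewrite /sdist bd; case: ifP => _; rewrite ?normrN ger0_norm ?enorm_ge0.
have yr y : enorm (y - x) < enorm (x - q) -> enorm (y - p) < rho.
  by move=> yx; have := ler_enorm_distD x y p; lra.
(* A sign change of [g] would give a boundary point nearer to [x] than [q]. *)
have nocross y : enorm (y - x) < enorm (x - q) ->
    ~ (Num.min (g x) (g y) <= 0 <= Num.max (g x) (g y)).
  move=> yx /boundary_on_segment -/(_ xr1 (yr _ yx))[s /andP[s0 s1] bs].
  have := qmin _ bs; rewrite opprD addrA subrr add0r enormN enormZ ger0_norm //.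
  have := enorm_ge0 (y - x); nra.
have gyle y : enorm (y - x) < enorm (x - q) ->
    `|g y - inner (G q) (y - q)| <= C * enorm (y - q) ^+ 2.
  move=> /yr yr1; have := gq _ _ qr yr1.
  by rewrite ((boundary_defining qr).1 bq) subr0.
have Gq : 0 < enorm (G q) by have := G1 _ qr; lra.
have normalize (c K : R) : 0 <= K -> 0 <= c + K -> 0 <= (enorm (G q))^-1 * c + K.
  move=> K0 cK; rewrite -(pmulr_rge0 _ Gq) mulrDr mulrA divff ?gt_eqF // mul1r.
  have := G1 _ qr; nra.
have Ce y : 0 <= C * enorm (y - q) ^+ 2 by rewrite mulr_ge0 ?sqr_ge0.
suff xq : x - q = sdist D x *: unit_normal q by rewrite -xq addrC subrK.
have Nq1 := enorm_unit_normal qr.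
rewrite /sdist bd; case: ifPn => [/set_mem Dx|/negP nDx].
  apply: (touching_ball C0 Nq1) => y yx; rewrite innerZl; apply: normalize => //.
  have gx := (gD _ xr1).1 Dx.
  have gy : 0 <= g y.
    rewrite leNgt; apply/negP => gy; apply: (nocross _ yx).
    by rewrite ge_min le_max (ltW gx) (ltW gy) orbT.
  by have := gyle _ yx; rewrite ler_norml => /andP[]; lra.
have gx : g x <= 0.
  by rewrite leNgt; apply/negP => /(gD _ xr1) Dx; apply/nDx/mem_set.
rewrite scaleNr -scalerN; apply: (touching_ball C0); first by rewrite enormN.
move=> y yx.
rewrite innerNl innerZl -mulrN; apply: normalize => //.
have gy : g y <= 0.
  rewrite leNgt; apply/negP => gy; apply: (nocross _ yx).
  by rewrite ge_min le_max gx (ltW gy) orbT.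
by have := gyle _ yx; rewrite ler_norml => /andP[]; lra.
Qed.

End Tube.

(** * Signed distance in normal coordinates *)

Section NormalCoordinates.
Context {R : realType} {m : nat}.
Implicit Types (S : set 'rV[R]_m) (p q x y a : 'rV[R]_m).

Lemma normal_expansion q q' a a' (t t' : R) : enorm a = 1 -> enorm a' = 1 ->
  t' - t - inner a (q' + t' *: a' - (q + t *: a)) =
  t' * enorm (a - a') ^+ 2 / 2 - inner a (q' - q).
Proof.
move=> a1 a'1.
have aa : inner a a = 1 by rewrite -sqr_enorm a1 expr1n.
have aa' : inner a' a' = 1 by rewrite -sqr_enorm a'1 expr1n.
by rewrite sqr_enorm opprD !innerE aa aa' (innerC a' a); field.
Qed.

Lemma normal_pythagoras q q' a a' (t t' : R) : enorm a = 1 -> enorm a' = 1 ->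
  enorm (q' + t' *: a' - (q + t *: a)) ^+ 2 - (t' - t) ^+ 2 =
  enorm (q' - q) ^+ 2 - 2 * t' * inner a' (q - q')
    - 2 * t * inner a (q' - q) + t * t' * enorm (a - a') ^+ 2.
Proof.
move=> a1 a'1.
have aa : inner a a = 1 by rewrite -sqr_enorm a1 expr1n.
have aa' : inner a' a' = 1 by rewrite -sqr_enorm a'1 expr1n.
rewrite !sqr_enorm opprD !innerE aa aa' (innerC a' a) (innerC q' q).
rewrite (innerC a' q') (innerC a' q) (innerC a q') (innerC a q); ring.
Qed.

(** The bounds on [q] and [d x] are those of a nearest point when [p] is itself a
competing boundary point. *)
Definition foot S (d : 'rV[R]_m -> R) (N : 'rV[R]_m -> 'rV[R]_m) p x q :=
  [/\ S q, enorm (q - p) <= 2 * enorm (x - p), x = q + d x *: N q &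
      `|d x| <= enorm (x - p)].

(** From here on [S] stands for the boundary, [d] for the signed distance and [N]
for the unit normal field; nothing else about them is used.  The radius for [N]
is doubled because a foot can be twice as far from [p] as the point. *)
Context (S : set 'rV[R]_m) (d : 'rV[R]_m -> R) (N : 'rV[R]_m -> 'rV[R]_m).
Context (p : 'rV[R]_m) (C r : R) (C0 : 0 <= C).
Context (footP : forall x, enorm (x - p) < r -> exists q, foot S d N p x q).
Context (N1 : forall q, S q -> enorm (q - p) < 2 * r -> enorm (N q) = 1).
Context (NL : forall q q', S q -> S q' ->
  enorm (q - p) < 2 * r -> enorm (q' - p) < 2 * r ->
  enorm (N q - N q') <= C * enorm (q - q')).
Context (NT : forall q q', S q -> S q' ->
  enorm (q - p) < 2 * r -> enorm (q' - p) < 2 * r ->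
  `|inner (N q) (q' - q)| <= C * enorm (q' - q) ^+ 2).
Context (dS : forall q, S q -> d q = 0).

(** The factor comparing squared distances of points at distance less than [h]
from [p] with those of their feet; it tends to 1 with [h]. *)
Definition shrink (h : R) := 1 - (4 * C * h + C ^+ 2 * h ^+ 2).

Lemma shrink_le1 (h : R) : 0 <= h -> shrink h <= 1.
Proof.
have := C0; move=> c0 h0; rewrite /shrink gerBl addr_ge0 ?mulr_ge0 ?sqr_ge0 //.
Qed.

(** In [normal_pythagoras] the inner products are at most [C |q' - q|^2] by
tangency, [|N q - N q'|] is at most [C |q' - q|], and the coefficients [d x],
[d y] are at most [h]. *)
Lemma foot_distance (h : R) x y q q' : h <= r ->
  enorm (x - p) < h -> enorm (y - p) < h ->
  foot S d N p x q -> foot S d N p y q' ->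
  shrink h * enorm (q' - q) ^+ 2 <= enorm (y - x) ^+ 2 - (d y - d x) ^+ 2.
Proof.
have c0 := C0.
move=> hr xh yh [Sq qp xE dx] [Sq' q'p yE dy].
have qr : enorm (q - p) < 2 * r by lra.
have q'r : enorm (q' - p) < 2 * r by lra.
rewrite {1}xE {1}yE normal_pythagoras; try exact: N1.
have := NT Sq Sq' qr q'r; have := NT Sq' Sq q'r qr; have := NL Sq Sq' qr q'r.
rewrite (enormB q q').
set e := enorm (q' - q); set n := enorm (N q - N q').
set i' := inner (N q') _; set i := inner (N q) _ => nL iT' iT.
have n2 : n ^+ 2 <= C ^+ 2 * e ^+ 2.
  by rewrite -exprMn lerXn2r ?nnegrE ?enorm_ge0 // mulr_ge0 // enorm_ge0.
have h0 : 0 <= h by have := enorm_ge0 (x - p); lra.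
have bound (t j K J : R) : `|t| <= K -> `|j| <= J -> `|t * j| <= K * J.
  by move=> tK jJ; rewrite normrM ler_pM.
have dxh : `|d x| <= h by lra.
have dyh : `|d y| <= h by lra.
have := bound _ _ _ _ dyh iT'; have := bound _ _ _ _ dxh iT.
have dxy := bound _ _ _ _ dxh dyh.
have nn : `|n ^+ 2| <= C ^+ 2 * e ^+ 2 by rewrite ger0_norm ?sqr_ge0.
have := bound _ _ _ _ dxy nn.
rewrite /shrink !ler_norml => /andP[b1 _] /andP[_ b2] /andP[_ b3].
lra.
Qed.

(** Since [shrink h <= 1], the bound on squared distances survives with
[shrink h ^+ 2] in place of [shrink h], which avoids a square root. *)
Lemma foot_lipschitz (h : R) x y q q' : 0 < shrink h -> h <= r ->
  enorm (x - p) < h -> enorm (y - p) < h ->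
  foot S d N p x q -> foot S d N p y q' ->
  enorm (q' - q) <= enorm (y - x) / shrink h.
Proof.
move=> k0 hr xh yh fx fy; have := foot_distance hr xh yh fx fy.
have k1 : shrink h <= 1.
  by apply: shrink_le1; have := enorm_ge0 (x - p); lra.
have := sqr_ge0 (d y - d x); set D2 := (_ - _) ^+ 2 => D20 H.
rewrite ler_pdivlMr // mulrC -ler_sqr ?nnegrE ?enorm_ge0 //; last first.
  by rewrite mulr_ge0 ?enorm_ge0 // ltW.
rewrite exprMn; have := sqr_ge0 (enorm (q' - q)).
set e := enorm (q' - q) ^+ 2 in H * => e0.
have : 0 <= shrink h * e * (1 - shrink h).
  by apply: mulr_ge0; [apply: mulr_ge0 => //; exact: ltW | rewrite subr_ge0].
lra.
Qed.

(** By [normal_expansion] the constant is that of the tangency estimate for [S],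
up to a term with the small factor [d y].  It is kept as a parameter [B]: the
crude value [C] yields differentiability, and the sharp value of
[chord_tangent], which itself relies on differentiability, yields the optimal
estimate. *)
Lemma foot_expansion (h B : R) x y q q' : 0 < shrink h -> 0 <= B -> h <= r ->
  (forall z z', S z -> S z' -> enorm (z - p) < 2 * h -> enorm (z' - p) < 2 * h ->
     `|inner (N z) (z' - z)| <= B * enorm (z' - z) ^+ 2) ->
  enorm (x - p) < h -> enorm (y - p) < h ->
  foot S d N p x q -> foot S d N p y q' ->
  shrink h * `|d y - d x - inner (N q) (y - x)| <=
  (B + C ^+ 2 * h / 2) * (enorm (y - x) ^+ 2 - (d y - d x) ^+ 2).
Proof.
move=> k0 B0 hr HB xh yh fx fy; have H := foot_distance hr xh yh fx fy.
have h0 : 0 <= h by have := enorm_ge0 (x - p); lra.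
have c0 := C0.
case: fx fy => [Sq qp xE dx] [Sq' q'p yE dy].
have qr : enorm (q - p) < 2 * r by lra.
have q'r : enorm (q' - p) < 2 * r by lra.
have K0 : 0 <= B + C ^+ 2 * h / 2.
  by rewrite addr_ge0 // divr_ge0 // mulr_ge0 ?sqr_ge0.
apply: le_trans (ler_wpM2l K0 H); rewrite mulrCA ler_wpM2l ?(ltW k0) //.
rewrite {2}xE {2}yE normal_expansion; try exact: N1.
have iB : `|inner (N q) (q' - q)| <= B * enorm (q' - q) ^+ 2.
  by apply: HB => //; lra.
have := NL Sq Sq' qr q'r; rewrite (enormB q q').
set e := enorm (q' - q) in iB *; set n := enorm (N q - N q') => nL.
have n2 : n ^+ 2 <= C ^+ 2 * e ^+ 2.
  by rewrite -exprMn lerXn2r ?nnegrE ?enorm_ge0 // mulr_ge0 // enorm_ge0.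
have dyn : `|d y * n ^+ 2| <= h * (C ^+ 2 * e ^+ 2).
  rewrite normrM; apply: ler_pM => //; first by lra.
  by rewrite ger0_norm ?sqr_ge0.
move: iB dyn; rewrite !ler_norml => /andP[i1 i2] /andP[d1 d2].
by apply/andP; split; lra.
Qed.

(** The subtracted square [(d y - d x)^2] can be dropped, and the estimate becomes
a quadratic expansion of [d]. *)
Lemma grad_foot (h : R) x q : 0 < shrink h -> h <= r -> enorm (x - p) < h ->
  foot S d N p x q -> differentiable d x /\ grad d x = N q.
Proof.
move=> k0 hr xh fx.
have h0 : 0 <= h by have := enorm_ge0 (x - p); lra.
have r0 : 0 < h - enorm (x - p) by rewrite subr_gt0.
apply: (differentiable_quadratic (K := (C + C ^+ 2 * h / 2) / shrink h) r0).
move=> y yx; have yh : enorm (y - p) < h by have := ler_enorm_distD x y p; lra.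
have [|q' fy] := @footP y; first by lra.
have NTh z z' : S z -> S z' -> enorm (z - p) < 2 * h -> enorm (z' - p) < 2 * h ->
    `|inner (N z) (z' - z)| <= C * enorm (z' - z) ^+ 2.
  by move=> Sz Sz' zh z'h; apply: NT => //; lra.
have expand := foot_expansion k0 C0 hr NTh xh yh fx fy.
have K0 : 0 <= C + C ^+ 2 * h / 2.
  by have := C0; move=> c0; rewrite addr_ge0 // divr_ge0 // mulr_ge0 ?sqr_ge0.
rewrite [leRHS]mulrAC ler_pdivlMr // [leLHS]mulrC; apply: le_trans expand _.
by rewrite ler_wpM2l // gerBl sqr_ge0.
Qed.

(** Along a chord [q, q'] of [S] the function [d] vanishes at both ends, so
Taylor's formula compares [<N q, q' - q>] with the variation of the gradient of
[d] along the chord, that is of [N] between foot points. *)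
Lemma chord_tangent (h M : R) q q' : 0 < shrink h -> h <= r -> 0 <= M ->
  (forall z z', S z -> S z' -> enorm (z - p) < 2 * h -> enorm (z' - p) < 2 * h ->
     enorm (N z - N z') <= M * enorm (z - z')) ->
  S q -> S q' -> enorm (q - p) < h -> enorm (q' - p) < h ->
  `|inner (N q) (q' - q)| <= M / (2 * shrink h) * enorm (q' - q) ^+ 2.
Proof.
move=> k0 hr M0 NM Sq Sq' qh q'h.
have fq : foot S d N p q q.
  split; rewrite ?dS // ?scale0r ?addr0 ?normr0 ?enorm_ge0 //.
  by rewrite ler_peMl ?enorm_ge0 // ler1n.
have seg (s : R) : 0 <= s <= 1 -> enorm (q + s *: (q' - q) - p) < h.
  by move=> s01; exact: ball_segment.
have [_ gq] := grad_foot k0 hr qh fq.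
have -> : `|inner (N q) (q' - q)| =
          `|d (q + (q' - q)) - d q - inner (grad d q) (q' - q)|.
  by rewrite [q + _]addrC subrK !dS // subrr sub0r normrN gq.
have -> : M / (2 * shrink h) * enorm (q' - q) ^+ 2 =
          M * enorm (q' - q) ^+ 2 / shrink h / 2 by field; rewrite gt_eqF.
apply: taylor_segment => s s01.
  have [|z fz] := @footP (q + s *: (q' - q)); first by have := seg _ s01; lra.
  by have [] := grad_foot k0 hr (seg _ s01) fz.
have [|z fz] := @footP (q + s *: (q' - q)); first by have := seg _ s01; lra.
have [_ ->] := grad_foot k0 hr (seg _ s01) fz; rewrite gq.
apply: le_trans (cauchy_schwarz _ _) _.
have zq := foot_lipschitz k0 hr qh (seg _ s01) fq fz.
have [Sz zp _ _] := fz; have zh := seg _ s01.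
have Nz : enorm (N z - N q) <= M * enorm (z - q).
  by apply: NM => //; have := enorm_ge0 (q - p); lra.
apply: le_trans (ler_wpM2r (enorm_ge0 _) Nz) _.
move: zq; rewrite addrAC subrr add0r enormZ (ger0_norm (proj1 (andP s01))) => zq.
have := ler_wpM2r (enorm_ge0 (q' - q)) (ler_wpM2l M0 zq) => /le_trans; apply.
by rewrite le_eqVlt; apply/orP; left; apply/eqP; field; rewrite gt_eqF.
Qed.

End NormalCoordinates.

(** * The limit superior of the slopes of the normal *)

Section Chi.
Context {R : realType} {m : nat}.
Context (D : set 'rV[R]_m) (p : 'rV[R]_m).

Let pairs := [set q : 'rV[R]_m * 'rV[R]_m |
  [/\ boundary D q.1, boundary D q.2 & q.1 != q.2]].

Let slope (q : 'rV[R]_m * 'rV[R]_m) : \bar R :=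
  (enorm (normal D q.1 - normal D q.2) / enorm (q.1 - q.2))%:E.

Lemma within_pairsP (A : set ('rV[R]_m * 'rV[R]_m)) :
  within pairs (nbhs (p, p)) A <-> exists2 e : R, 0 < e &
    forall q q', boundary D q -> boundary D q' -> q != q' ->
      enorm (q - p) < e -> enorm (q' - p) < e -> A (q, q').
Proof.
split.
  move=> [[P Q] /= [/nbhs_enormP[e1 e10 eP] /nbhs_enormP[e2 e20 eQ]] PQ].
  exists (Num.min e1 e2); first by rewrite lt_min e10.
  move=> q q' bq bq' qq'; rewrite !lt_min => /andP[q1 _] /andP[_ q2].
  by apply: (PQ (q, q')); split => //=; [exact: eP | exact: eQ].
move=> [e e0 eA].
exists ([set q | enorm (q - p) < e], [set q | enorm (q - p) < e]) => /=.
  by split; apply/nbhs_enormP; exists e.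
by move=> [q q'] /= [qe q'e] [bq bq' qq']; exact: eA.
Qed.

Lemma chi_le (M e : R) : 0 < e ->
  (forall q q', boundary D q -> boundary D q' ->
     enorm (q - p) < e -> enorm (q' - p) < e ->
     enorm (normal D q - normal D q') <= M * enorm (q - q')) ->
  (chi D p <= M%:E)%E.
Proof.
move=> e0 H; pose A q := (slope q <= M%:E)%E.
have FA : within pairs (nbhs (p, p)) A.
  apply/within_pairsP; exists e => // q q' bq bq' qq' qe q'e.
  rewrite /A /slope lee_fin ler_pdivrMr; first exact: H.
  by rewrite enorm_gt0 // subr_eq0.
apply: (@le_trans _ _ (ereal_sup (slope @` A))).
  by apply: ereal_inf_lbound; exists A.
by apply: ge_ereal_sup => _ [q Aq <-].
Qed.

Lemma chi_lt (M : R) : (chi D p < M%:E)%E ->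
  exists2 e : R, 0 < e & forall q q', boundary D q -> boundary D q' ->
     enorm (q - p) < e -> enorm (q' - p) < e ->
     enorm (normal D q - normal D q') <= M * enorm (q - q').
Proof.
move=> /ereal_inf_lt[_ [A FA <-] AM].
have /within_pairsP[e e0 eA] := FA.
exists e => // q q' bq bq' qe q'e.
have [->|qq'] := eqVneq q q'; first by rewrite !subrr !enorm0 mulr0.
rewrite -ler_pdivrMr ?enorm_gt0 ?subr_eq0 // -lee_fin.
apply: le_trans (ltW AM); apply: ereal_sup_ubound.
by exists (q, q') => //; exact: eA.
Qed.

(** Without boundary points accumulating at [p] the family of pairs would be
empty near [(p, p)] and the limit superior would be [-oo]. *)
Lemma chi_ge0 : boundary D p ->
  (forall e : R, 0 < e -> exists q, [/\ boundary D q, q != p & enorm (q - p) < e]) ->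
  (0 <= chi D p)%E.
Proof.
move=> bp acc; apply: le_ereal_inf_tmp => _ [A FA <-].
have /within_pairsP[e e0 eA] := FA.
have [q [bq qp qe]] := acc e e0.
apply: (@le_trans _ _ (slope (q, p))).
  by rewrite lee_fin divr_ge0 ?enorm_ge0.
apply: ereal_sup_ubound; exists (q, p) => //.
by apply: eA => //; rewrite subrr enorm0.
Qed.

End Chi.

(** * The optimal constant *)

Lemma sdist_boundary {R : realType} {m : nat} (D : set 'rV[R]_m) q :
  boundary D q -> sdist D q = 0.
Proof.
move=> bq; suff b0 : bdist D q = 0 by rewrite /sdist b0 oppr0 if_same.
apply/eqP; rewrite eq_le; apply/andP; split.
  apply: ge_inf; first by exists 0 => _ [z _ <-]; exact: enorm_ge0.
  by exists q => //; rewrite subrr enorm0.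
apply: lb_le_inf; first by exists (enorm (q - q)), q.
by move=> _ [z _ <-]; exact: enorm_ge0.
Qed.

(** The points whose foot is [p] lie on a line, so in dimension at least two
some point near [p] has another foot. *)
Lemma exists_other_foot {R : realType} {m : nat} (S : set 'rV[R]_m)
    (d : 'rV[R]_m -> R) (N : 'rV[R]_m -> 'rV[R]_m) (p : 'rV[R]_m) (r e : R) :
  (1 < m)%N -> 0 < r -> 0 < e ->
  (forall x, enorm (x - p) < r -> exists q, foot S d N p x q) ->
  exists q, [/\ S q, q != p & enorm (q - p) < e].
Proof.
move=> m1 r0 e0 footP; pose s := Num.min (r / 2) (e / 3).
have s0 : 0 < s by rewrite lt_min !divr_gt0.
have [sr se] : s <= r / 2 /\ s <= e / 3 by rewrite !ge_min !lexx orbT.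
pose i0 : 'I_m := Ordinal (ltnW m1); pose i1 : 'I_m := Ordinal m1.
have i01 : i0 != i1 by [].
pose v i : 'rV[R]_m := s *: delta_mx 0 i.
have vn i : enorm (v i) = s.
  rewrite enormZ gtr0_norm // /enorm inner_delta mxE !eqxx sqrtr1 mulr1 //.
have vv : inner (v i0) (v i1) = 0.
  by rewrite innerZl innerZr inner_delta mxE eq_sym (negPf i01) !mulr0.
have ft i : exists2 q, S q & enorm (q - p) < e /\ (q = p -> exists t, v i = t *: N p).
  have [|q [Sq qp vE _]] := @footP (p + v i).
    by rewrite [p + _]addrC addrK vn; lra.
  move: qp; rewrite [p + _]addrC addrK vn => qp.
  exists q => //; split; first by lra.
  move=> qE; exists (d (p + v i)); move: vE; rewrite qE => /addrI.
  by [].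
have [q0 S0 [e00 H0]] := ft i0; have [q1 S1 [e1 H1]] := ft i1.
have [E0|n0] := eqVneq q0 p; last by exists q0.
have [E1|n1] := eqVneq q1 p; last by exists q1.
have [t0 v0] := H0 E0; have [t1 v1] := H1 E1.
move: vv; rewrite v0 innerZl v1 innerZr => /eqP.
have vn0 i : v i != 0.
  by apply/eqP => v0'; have := vn i; rewrite v0' enorm0; lra.
rewrite !mulf_eq0 => /or3P[/eqP t00|/eqP t10|/eqP NN].
- by have := vn0 i0; rewrite v0 t00 scale0r eqxx.
- by have := vn0 i1; rewrite v1 t10 scale0r eqxx.
- by have := vn0 i0; rewrite v0 (inner_eq0 NN) scaler0 eqxx.
Qed.

Lemma shrink_ge {R : realType} (C h : R) : 0 <= C -> 0 <= h <= 1 ->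
  1 - (4 * C + C ^+ 2) * h <= shrink C h.
Proof.
move=> C0 /andP[h0 h1]; rewrite /shrink.
have : C ^+ 2 * h ^+ 2 <= C ^+ 2 * h.
  by rewrite ler_wpM2l ?sqr_ge0 // expr2 ler_piMl.
lra.
Qed.

(** With [k] the value of [shrink], [1 - t <= k] gives [1 - 2 t <= k^2]; the slack
[e] between [c + e] and [c + 2 e] absorbs both [2 t] and [b]. *)
Lemma rate_bound {R : realType} (c e k t b : R) :
  0 <= c -> 0 <= b -> 0 < e -> 0 < k <= 1 -> 1 - t <= k ->
  2 * t * (c + 2 * e) + b <= e ->
  (c + e) / (2 * k) + b / 2 <= (c / 2 + e) * k.
Proof.
move=> c0 b0 e0 /andP[k0 k1] tk te.
have -> : (c + e) / (2 * k) + b / 2 = (c + e + b * k) / (2 * k).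
  by field; rewrite gt_eqF.
rewrite ler_pdivrMr ?mulr_gt0 //.
have k2 : 1 - 2 * t <= k ^+ 2 by have := sqr_ge0 (k - 1); lra.
have : (c + 2 * e) * (1 - 2 * t) <= (c + 2 * e) * k ^+ 2.
  by rewrite ler_wpM2l //; lra.
have : b * k <= b by rewrite ler_piMr.
lra.
Qed.

Unset Implicit Arguments.

Theorem proposition8 (R : realType) (m : nat) (hm : (2 <= m)%N)
    (D : set 'rV[R]_m) (hD : domain D) (hDT : D `<` setT)
    (p : 'rV[R]_m) (hpD : boundary D p) (hp : C11_boundary_point D p) :
  (exists U : set 'rV[R]_m, [/\ open U, U p & C11_on U (sdist D)]) /\
  (forall eps : R, 0 < eps ->
     exists2 V : set 'rV[R]_m, nbhs p V &
       forall x y : 'rV[R]_m, V x -> V y ->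
         (`|sdist D x - sdist D y - inner (grad (sdist D) x) (x - y)|%:E <=
          (chi D p * (2^-1)%:E + eps%:E) *
          (enorm (x - y) ^+ 2 - (sdist D x - sdist D y) ^+ 2)%:E)%E).
Proof.
have [_ _ oD] := hD.
have [g [G [C [rho [C0 rho0 dfg]]]]] := C11_boundary_point_defining_function hp.
pose N := unit_normal G; pose r := rho / 2.
have r0 : 0 < r by rewrite divr_gt0.
have r2 : 2 * r = rho by rewrite /r; field.
(* The radius is halved because feet are sought within twice the distance. *)
have footP x : enorm (x - p) < r -> exists q, foot (boundary D) (sdist D) N p x q.
  by move=> xr; apply: (foot_point_exists oD C0 dfg hpD); lra.
have N1 q : boundary D q -> enorm (q - p) < 2 * r -> enorm (N q) = 1.
  by rewrite r2 => _; exact: (enorm_unit_normal dfg).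
have NL q q' : boundary D q -> boundary D q' ->
    enorm (q - p) < 2 * r -> enorm (q' - p) < 2 * r ->
    enorm (N q - N q') <= C * enorm (q - q').
  by rewrite r2 => _ _; exact: (unit_normal_lipschitz dfg).
have NT q q' : boundary D q -> boundary D q' ->
    enorm (q - p) < 2 * r -> enorm (q' - p) < 2 * r ->
    `|inner (N q) (q' - q)| <= C * enorm (q' - q) ^+ 2.
  by rewrite r2; exact: (unit_normal_tangent oD C0 dfg).
have dS q : boundary D q -> sdist D q = 0 by exact: sdist_boundary.
pose c1 := 4 * C + C ^+ 2.
have c10 : 0 <= c1 by rewrite addr_ge0 ?sqr_ge0 ?mulr_ge0.
(* This radius makes [shrink C] at least [3 / 4] on the whole ball. *)
pose h := Num.min r (4 * (c1 + 1))^-1.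
have h0 : 0 < h by rewrite lt_min r0 invr_gt0; lra.
have [hr hc] : h <= r /\ h <= (4 * (c1 + 1))^-1 by rewrite !ge_min !lexx orbT.
have hc1 : h * (4 * (c1 + 1)) <= 1 by rewrite -ler_pdivlMr ?div1r //; lra.
have h1 : h <= 1 by have := mulr_ge0 (ltW h0) c10; lra.
have k0 t : 0 <= t <= h -> 0 < shrink C t.
  move=> /andP[t0 th]; have : 0 <= t <= 1 by apply/andP; split; lra.
  move/(shrink_ge C0); rewrite -/c1; have : c1 * t <= c1 * h by rewrite ler_wpM2l.
  lra.
have kh : 0 < shrink C h by apply: k0; rewrite lexx ltW.
have gradE x q : enorm (x - p) < h -> foot (boundary D) (sdist D) N p x q ->
    differentiable (sdist D) x /\ grad (sdist D) x = N q.
  exact: (grad_foot C0 footP N1 NL NT kh hr).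
have normalE q : boundary D q -> enorm (q - p) < h -> normal D q = N q.
  move=> bq qh; apply: (gradE _ _ qh _).2.
  split; rewrite ?dS // ?scale0r ?addr0 ?normr0 ?enorm_ge0 //.
  by rewrite ler_peMl ?enorm_ge0 // ler1n.
split.
  exists [set x | enorm (x - p) < h].
  split; [exact: open_eball | by rewrite /= subrr enorm0 |].
  split=> [x /= xh|x /= xh].
    have [|q fx] := footP x; first by lra.
    by have [] := gradE _ _ xh fx.
  exists [set x | enorm (x - p) < h], (C / shrink C h); split.
    by apply: open_nbhs_nbhs; split=> //; exact: open_eball.
  move=> y z /= yh _ zh _.
  have [|q fy] := footP y; first by lra.
  have [|q' fz] := footP z; first by lra.
  rewrite (gradE _ _ yh fy).2 (gradE _ _ zh fz).2.
  have [bq qp _ _] := fy; have [bq' q'p _ _] := fz.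
  have : enorm (N q - N q') <= C * enorm (q - q') by apply: NL => //; lra.
  move/le_trans; apply; rewrite mulrAC -mulrA ler_wpM2l //.
  exact: (foot_lipschitz C0 N1 NL NT kh hr zh yh fz fy).
have chi0 : (0 <= chi D p)%E.
  by apply: chi_ge0 => // e e0; exact: (exists_other_foot hm r0 e0 footP).
have chiC : (chi D p <= C%:E)%E.
  apply: (chi_le h0) => q q' bq bq' qh q'h.
  by rewrite !normalE //; apply: NL => //; lra.
have [c chiE] : exists c, chi D p = c%:E.
  exists (fine (chi D p)); rewrite fineK // ge0_fin_numE //.
  exact: le_lt_trans chiC (ltry _).
have c0 : 0 <= c by rewrite -lee_fin -chiE.
move=> eps eps0.
have [|e e0 eN] := @chi_lt _ _ D p (c + eps).
  by rewrite chiE lte_fin ltrDl.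
(* [t <= eps / K] makes [t] as small as [rate_bound] asks. *)
pose K := 1 + 2 * c1 * (c + 2 * eps) + C ^+ 2 / 2.
have K0 : 0 < K.
  rewrite /K !ltr_wpDr ?divr_ge0 ?sqr_ge0 // mulr_ge0 ?mulr_ge0 //; lra.
pose t := Num.min (Num.min (h / 2) (e / 2)) (eps / K).
have t0 : 0 < t by rewrite !lt_min !divr_gt0.
have [th [te tK]] : t <= h / 2 /\ t <= e / 2 /\ t <= eps / K.
  by rewrite /t !ge_min !lexx !orbT.
have kt : 0 < shrink C t by apply: k0; apply/andP; split; lra.
have kt2 : 0 < shrink C (t / 2) by apply: k0; apply/andP; split; lra.
(* Feet of points of this ball lie within [t] of [p], where [chord_tangent]
   applies; it uses in turn feet within [2 * t], where [chi_lt] applies. *)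
exists [set x | enorm (x - p) < t / 2].
  by apply: open_nbhs_nbhs; split; [exact: open_eball | rewrite /= subrr enorm0; lra].
move=> x y /= xt yt.
have [|q fx] := footP x; first by lra.
have [|q' fy] := footP y; first by lra.
have M0 : 0 <= c + eps by lra.
have tr : t <= r by lra.
have NM z z' : boundary D z -> boundary D z' ->
    enorm (z - p) < 2 * t -> enorm (z' - p) < 2 * t ->
    enorm (N z - N z') <= (c + eps) * enorm (z - z').
  by move=> bz bz' zt z't; rewrite -!normalE ?eN //; lra.
have B0 : 0 <= (c + eps) / (2 * shrink C t).
  by rewrite divr_ge0 // mulr_ge0 // ltW.
have t2r : t / 2 <= r by lra.
have chord z z' : boundary D z -> boundary D z' ->
    enorm (z - p) < 2 * (t / 2) -> enorm (z' - p) < 2 * (t / 2) ->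
    `|inner (N z) (z' - z)| <= (c + eps) / (2 * shrink C t) * enorm (z' - z) ^+ 2.
  have -> : 2 * (t / 2) = t by field.
  move=> bz bz' zt z't.
  exact: (chord_tangent C0 footP N1 NL NT dS kt tr M0 NM).
have := foot_expansion C0 N1 NL NT kt2 B0 t2r chord xt yt fx fy.
have := foot_distance C0 N1 NL NT t2r xt yt fx fy.
have xh : enorm (x - p) < h by lra.
rewrite -(gradE _ _ xh fx).2 chiE -EFinM lee_fin.
have -> : sdist D x - sdist D y - inner (grad (sdist D) x) (x - y) =
  - (sdist D y - sdist D x - inner (grad (sdist D) x) (y - x)).
  by rewrite !innerE; ring.
rewrite normrN (enormB x y) -(opprB (sdist D y)) sqrrN.
set A := `|_|; set Q := enorm (y - x) ^+ 2 - _ => Q0 main.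
have Qge0 : 0 <= Q.
  by apply: le_trans Q0; rewrite mulr_ge0 ?sqr_ge0 // ltW.
have A0 : 0 <= A by exact: normr_ge0.
have C2t : 0 <= C ^+ 2 * t by rewrite mulr_ge0 ?sqr_ge0 // ltW.
have kmono : shrink C t <= shrink C (t / 2).
  have : 0 <= C * t by rewrite mulr_ge0 // ltW.
  rewrite /shrink; have := mulr_ge0 C2t (ltW t0); lra.
have rate : (c + eps) / (2 * shrink C t) + C ^+ 2 * t / 2 / 2 <=
    (c / 2 + eps) * shrink C t.
  apply: (@rate_bound _ _ _ _ (c1 * t)) => //.
  - by rewrite divr_ge0.
  - by rewrite kt shrink_le1 // ltW.
  - by apply: shrink_ge => //; apply/andP; split; lra.
  - move: tK; rewrite ler_pdivlMr // /K; lra.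
rewrite -(ler_pM2l kt); apply: (@le_trans _ _ (shrink C (t / 2) * A)).
  by rewrite ler_wpM2r.
apply: le_trans main _; rewrite mulrA ler_wpM2r //.
by move: rate; lra.
Qed.
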